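(* Let $\Gamma$ be an infinite torsion-free Abelian group and let $T$ be a tree of diameter $4$ with central vertex $v_c$. Then $T$ is $\Gamma$-vertex magic if and only if $T$ satisfies one of the following: (i) every non-pendant vertex of $T$ is in $\Omega_{\mathfrak{s}}(T)$; (ii) $v_c\in \Omega_{\mathfrak{w}}(T)$ and all other non-pendant vertices of $T$ are in $\Omega_{\mathfrak{s}}(T)$.
   Context: Graphs are finite, simple and undirected. For an additive Abelian group $\Gamma$ with identity $0$ and a graph $G$, a $\Gamma$-vertex magic labeling is a map $\ell:V(G)\to\Gamma\setminus\{0\}$ for which there is $\mu\in\Gamma$ (the magic constant) with $w(v)=\sum_{u\in N(v)}\ell(u)=\mu$ for every vertex $v$; $G$ is $\Gamma$-vertex magic if it has such a labeling. A pendant vertex has degree $1$; a support vertex is a vertex adjacent to a pendant vertex. $\Omega_{\mathfrak{s}}(T)$ is the set of strong support vertices (adjacent to at least two pendant vertices), $\Omega_{\mathfrak{w}}(T)$ the set of weak support vertices (adjacent to exactly one pendant vertex). A tree of diameter $4$ has a unique central vertex $v_c$. An Abelian group is torsion-free if $0$ is its only element of finite order. *)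

(* Defs.v *)
From HB Require Import structures.
From mathcomp Require Import all_boot all_order all_algebra.
From mathcomp Require classical_sets cardinality.

Set Implicit Arguments.
Unset Strict Implicit.
Unset Printing Implicit Defensive.

Import GRing.Theory.
Local Open Scope ring_scope.

Record sgraph := SGraph {
  vertex :> finType;
  adj : rel vertex;
  adj_sym : symmetric adj;
  adj_irrefl : irreflexive adj
}.

Section Graph.
Variable G : sgraph.
Implicit Types u v w : G.
Local Open Scope nat_scope.

Definition neighbors v : {set G} := [set u | adj v u].

Definition pendant v : bool := #|neighbors v| == 1.

Definition pendant_neighbors v : {set G} := [set u in neighbors v | pendant u].

Definition strong_supports : {set G} := [set v | 2 <= #|pendant_neighbors v|].

Definition weak_supports : {set G} := [set v | #|pendant_neighbors v| == 1].

Definition connected_graph : Prop :=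
  0 < #|G| /\ forall u v, connect (@adj G) u v.

(* A sequence of two adjacent vertices is a [ucycle]: it closes up by using the
   same edge twice.  Genuine cycles are those with at least three vertices. *)
Definition acyclic : Prop := forall c : seq G, ucycle (@adj G) c -> size c <= 2.

Definition is_tree : Prop := connected_graph /\ acyclic.

Definition has_walk u v (n : nat) : bool :=
  [exists p : n.-tuple G, path (@adj G) u p && (last u p == v)].

(* Least length of a walk from [u] to [v].  A shortest walk has fewer than
   [#|G|] edges; the junk value [#|G|] is returned if there is none. *)
Definition dist u v : nat := find (has_walk u v) (iota 0 #|G|).

Definition eccentricity v : nat := \max_(w : G) dist v w.

Definition diameter : nat := \max_(v : G) eccentricity v.

Definition center : {set G} :=
  [set v | [forall w, eccentricity v <= eccentricity w]].

End Graph.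

Section Magic.
Variables (Gamma : zmodType) (G : sgraph).

Definition weight (l : G -> Gamma) (v : G) : Gamma :=
  \sum_(u in neighbors v) l u.

Definition vertex_magic_labeling (l : G -> Gamma) : Prop :=
  (forall v, l v != 0) /\ exists mu : Gamma, forall v, weight l v = mu.

Definition vertex_magic : Prop := exists l : G -> Gamma, vertex_magic_labeling l.

End Magic.

Definition torsion_free (Gamma : zmodType) : Prop :=
  forall (x : Gamma) (n : nat), (0 < n)%N -> x *+ n = 0 -> x = 0.

Definition infinite_group (Gamma : zmodType) : Prop :=
  cardinality.infinite_set (@classical_sets.setT Gamma).

(* Main.v *)
(** In a tree of diameter 4 every vertex is within distance 2 of the center
    [vc], so a non-pendant vertex other than [vc] is adjacent to [vc] and all its
    other neighbors are pendant.  The neighbor of a pendant vertex has label [mu],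
    the magic constant.  Were [vc] not a support vertex, its [k >= 2] neighbors
    would all be labeled [mu], so that [k mu = mu], hence [mu = 0].  So [vc] is
    labeled [mu] as well, and the pendant neighbors of any other non-pendant
    vertex have labels of sum 0: there are at least two of them.  Conversely,
    under (i) or (ii) every non-pendant vertex is a support vertex of degree at
    least 3, and the labels [m] and [(2 - deg v) m] suffice for any [m <> 0]. *)

Require Import Defs.
From HB Require Import structures.
From mathcomp Require Import all_boot all_order all_algebra.
From mathcomp Require boolp classical_sets cardinality.

Set Implicit Arguments.
Unset Strict Implicit.
Unset Printing Implicit Defensive.

Import GRing.Theory.

(** * Walks, shortest paths and distance *)

Section Distance.
Variable G : sgraph.
Implicit Types u v w x : G.
Local Open Scope nat_scope.

Lemma mem_neighbors v u : (u \in neighbors v) = adj v u.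
Proof. by rewrite inE. Qed.

Lemma adj_neq u v : adj u v -> u != v.
Proof. by apply: contraTneq => ->; rewrite adj_irrefl. Qed.

Lemma dist_le_size u p : path (@adj G) u p -> dist u (last u p) <= size p.
Proof.
move=> up; rewrite /dist; set s := iota 0 #|G|; set a := has_walk u (last u p).
(* A walk of at least [#|G|] edges is no obstacle, since the search behind [dist] never returns more
   than [#|G|]. *)
have [ltp|gep] := ltnP (size p) #|G|; last first.
  by apply: leq_trans gep; rewrite -[X in _ <= X](size_iota 0) find_size.
rewrite leqNgt; apply/negP => /(before_find 0).
rewrite nth_iota // add0n => /negbT/negP; apply.
by apply/existsP; exists (in_tuple p); rewrite up eqxx.
Qed.

Lemma dist_path u v : connect (@adj G) u v ->
  exists2 p, path (@adj G) u p & [/\ last u p = v, uniq (u :: p) & size p = dist u v].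
Proof.
case/connectP => p0 up0 ->{v}.
case/shortenP: up0 => p up Up _ {p0}; set v := last u p.
have hasw : has (has_walk u v) (iota 0 #|G|).
  apply/hasP; exists (size p).
    by rewrite mem_iota /=; have := max_card (mem (u :: p)); rewrite (card_uniqP Up).
  by apply/existsP; exists (in_tuple p); rewrite up eqxx.
have := nth_find 0 hasw; rewrite has_find size_iota in hasw.
rewrite nth_iota // add0n -/(dist u v) => /existsP[q /andP[uq /eqP Dv]].
(* Removing repetitions from a shortest walk cannot shorten it, so the result still has length
   [dist u v]. *)
move: (size_tuple q) Dv; case/shortenP: uq => q' uq' Uq' sub szq Dv.
exists q' => //; split=> //; apply/eqP; rewrite eqn_leq -{2}Dv dist_le_size // andbT.
by rewrite -szq; apply: uniq_leq_size => //; case/andP: Uq'.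
Qed.

Lemma dist_le_ecc u v : dist u v <= eccentricity u.
Proof. exact: (leq_bigmax (F := dist u)). Qed.

Lemma dist_le_diameter u v : dist u v <= diameter G.
Proof. exact: leq_trans (dist_le_ecc u v) (leq_bigmax (F := @eccentricity G) u). Qed.

Lemma diameter_attained : 0 < #|G| -> exists u v, dist u v = diameter G.
Proof.
move=> G0; have [u Du] := eq_bigmax (@eccentricity G) G0.
have [v Dv] := eq_bigmax (dist u) G0.
by exists u, v; rewrite /diameter Du [RHS]/eccentricity Dv.
Qed.

Lemma rev_path_adj u p : path (@adj G) u p ->
  path (@adj G) (last u p) (rev (belast u p)).
Proof. by rewrite rev_path; rewrite (eq_path (e' := @adj G)) // => x y; rewrite adj_sym. Qed.

End Distance.

(** * Uniqueness of paths in acyclic graphs *)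

Section Forest.
Variable G : sgraph.
Hypothesis G_acyclic : acyclic G.
Implicit Types u v w x : G.
Local Open Scope nat_scope.

(* At the first vertex [z] of the first path lying on the second one, the two
   initial segments close up to a cycle through [x], [y1], [y2] and [z]. *)
Lemma acyclic_branch_disjoint x y1 y2 p q :
    path (@adj G) x (y1 :: p) -> path (@adj G) x (y2 :: q) ->
    uniq (x :: y1 :: p) -> uniq (x :: y2 :: q) -> y1 != y2 ->
  ~~ has (mem (y2 :: q)) (y1 :: p).
Proof.
move=> xp xq Up Uq ne12; apply/negP => hpq.
(* The first vertices are recorded through [head], so that both lists can be split at arbitrary
   places. *)
move: ne12; have: head x (y1 :: p) = y1 by []. have: head x (y2 :: q) = y2 by [].
move: hpq xp xq Up Uq; move: (y1 :: p) (y2 :: q) => {p q} p q.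
case/split_find => z p1 p2 zq nzp1; case/splitPr: zq nzp1 => q1 q2 nzp1.
move=> xp xq Up Uq hq hp ne.
move: xp; rewrite cat_path rcons_path => /andP[/andP[xp1 p1z] _].
move: xq; rewrite cat_path /= => /and3P[xq1 q1z _].
move: Up; rewrite cat_rcons -cat_cons cat_uniq => /and3P[Up1 /hasPn dp1 _].
move: Uq; rewrite -cat_cons cat_uniq => /and3P[Uq1 /hasPn dq1 _].
have cyc : ucycle (@adj G) (x :: p1 ++ z :: rev q1).
  apply/andP; split; last first.
    rewrite -cat_cons cat_uniq Up1 [uniq (z :: _)]cons_uniq mem_rev rev_uniq.
    have /andP[xq1' ->] : (x \notin q1) && uniq q1 by [].
    rewrite andbT [has _ _]/=.
    have := dp1 z; rewrite mem_head => /(_ isT) /negbTE ->.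
    have := dq1 z; rewrite mem_head inE negb_or => /(_ isT) /andP[_ ->].
    rewrite !andbT; apply/hasPn => t; rewrite mem_rev => tq.
    rewrite inE negb_or; apply/andP; split.
      by apply: contraNneq xq1' => <-.
    apply: contraNN nzp1 => tp; apply/hasP; exists t => //=.
    by rewrite mem_cat tq.
  have -> : cycle (@adj G) (x :: p1 ++ z :: rev q1) =
     path (@adj G) x (p1 ++ z :: rev (x :: q1)).
    by rewrite /= rcons_cat /= rev_cons.
  rewrite cat_path xp1 /= p1z.
  have := @rev_path_adj G x (rcons q1 z).
  by rewrite last_rcons belast_rcons; apply; rewrite rcons_path xq1.
(* A cycle of at most two vertices forces [p1] and [q1] to be empty, so both paths start with
   [z]. *)
have := G_acyclic cyc; rewrite /= size_cat /= size_rev !addnS !ltnS leqn0 addn_eq0.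
case/andP => /nilP p10 /nilP q10.
by move: ne; rewrite -hp -hq p10 q10 /= eqxx.
Qed.

(** Follow the common prefix; once the paths branch they are disjoint, which contradicts their
    common endpoint. *)
Lemma acyclic_path_unique u p q :
    path (@adj G) u p -> path (@adj G) u q ->
    uniq (u :: p) -> uniq (u :: q) -> last u p = last u q ->
  p = q.
Proof.
elim: p u q => [|y p IHp] u [|z q] //.
- by move=> _ _ _ /andP[/negP uq _] /= Du; case: uq; rewrite Du mem_last.
- by move=> _ _ /andP[/negP up _] _ /= Du; case: up; rewrite -Du mem_last.
move=> up uq Up Uq Dv; have [Dy|neyz] := eqVneq y z.
  move: up uq Up Uq Dv; rewrite -Dy /= => /andP[_ yp] /andP[_ yq].
  by move=> /andP[_ Up] /andP[_ Uq] Dv; rewrite (IHp y q).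
case/hasP: (acyclic_branch_disjoint up uq Up Uq neyz).
by exists (last y p); rewrite ?mem_last //= (Dv : last y p = last z q) mem_last.
Qed.

Lemma acyclic_dist u p : path (@adj G) u p -> uniq (u :: p) ->
  dist u (last u p) = size p.
Proof.
move=> up Up; have cup : connect (@adj G) u (last u p) by apply/connectP; exists p.
have [q uq [Dq Uq <-]] := dist_path cup.
by rewrite (acyclic_path_unique uq up).
Qed.

End Forest.

(** * Structure of trees of diameter 4 around the center *)

Section Diameter4.
Variable T : sgraph.
Hypotheses (T_tree : is_tree T) (T_diam : diameter T = 4).
Implicit Types u v w x : T.
Local Open Scope nat_scope.

Let T_conn u v : connect (@adj T) u v.
Proof. by case: T_tree => -[_]. Qed.

Let T_acyc : acyclic T.
Proof. by case: T_tree. Qed.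

(* A path of length at least 3 out of the middle vertex [c] of a diametral path
   [a b c d e] leaves [c] away from [b] or from [d]; glued to the opposite half
   it gives a path of length at least 5. *)
Lemma exists_ecc_le2 : exists c : T, eccentricity c <= 2.
Proof.
have [a [e Dae]] : exists a e : T, dist a e = diameter T.
  by apply: diameter_attained; case: T_tree => -[].
have [p ap [_ Up]] := dist_path (T_conn a e); rewrite Dae T_diam.
case: p ap Up => [|b [|c [|d [|e' [|]]]]] //= /and5P[ab bc cd de _] Up _.
exists c; rewrite /eccentricity; apply/bigmax_leqP => w _.
have [q cq [Dw Uq szq]] := dist_path (T_conn c w).
rewrite leqNgt -szq; apply/negP => gt2.
(* Here [c], [y], [z] is the half of the diametral path that [q] does not enter; gluing adds 2 to a
   length of at least 3. *)
have far (y z : T) : adj c y -> adj y z -> uniq [:: c; y; z] ->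
    head c q != y -> False.
  move=> cy yz Ucyz; case: q cq Dw Uq szq gt2 => // h q cq Dw Uq _ gt2 /= ney.
  have := @acyclic_branch_disjoint T T_acyc c h y q [:: z] cq.
  rewrite [path _ _ _]/= cy yz => /(_ isT Uq Ucyz ney) dis.
  have zp : path (@adj T) z [:: y, c, h & q].
    by rewrite /= adj_sym yz adj_sym cy.
  have Uz : uniq [:: z, y, c, h & q].
    have -> : [:: z, y, c, h & q] = [:: z; y] ++ [:: c, h & q] by [].
    move: Ucyz; rewrite cat_uniq Uq andbT /= !inE !negb_or !andbT.
    case/andP=> /andP[ncy ncz] nyz; rewrite eq_sym nyz ncy ncz.
    by move: dis; rewrite /= !inE !negb_or => /andP[/andP[-> ->]] /hasPn dis;
       apply/hasPn => t /dis; rewrite /= !inE orbC.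
  have := dist_le_diameter z (last z [:: y, c, h & q]).
  by rewrite (acyclic_dist T_acyc zp Uz) T_diam /= leqNgt; move: gt2; rewrite /= !ltnS => ->.
move: Up; rewrite !inE !negb_or -!andbA.
case/and5P=> nab nac nad nae /and5P[nbc nbd nbe ncd /and3P[nce nde _]].
have [hb|] := eqVneq (head c q) b.
  by apply: (far d e') => //; rewrite ?hb //= !inE !negb_or ncd nce nde.
apply: (far b a); rewrite ?[adj c b]adj_sym ?[adj b a]adj_sym //=.
by rewrite !inE !negb_or ![_ == a]eq_sym ![c == _]eq_sym nbc nac nab.
Qed.

Section Center.
Variable c : T.
Hypothesis c_center : c \in center T.

Lemma center_dist_le2 w : dist c w <= 2.
Proof.
have [c' ec'] := exists_ecc_le2; apply: leq_trans (dist_le_ecc c w) _.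
by move: c_center; rewrite inE => /forallP/(_ c')/leq_trans; apply.
Qed.

Variant center_spec w : Prop :=
  | CenterEq of w = c
  | CenterAdj of adj c w
  | CenterFar y of adj c y & adj y w & w != c & ~~ adj c w.

Lemma centerP w : center_spec w.
Proof.
have [->|wc] := eqVneq w c; first exact: CenterEq.
case/boolP: (adj c w) => cw; first exact: CenterAdj.
have [p cp [Dw _ szp]] := dist_path (T_conn c w).
have := center_dist_le2 w; rewrite -szp.
case: p cp Dw {szp} => [|y [|z []]] //=.
- by move=> _ Dw; rewrite Dw eqxx in wc.
- by rewrite andbT => cy Dw; rewrite -Dw cy in cw.
- by case/and3P=> cy yw _ Dz _; rewrite Dz in yw; apply: (CenterFar cy).
Qed.

(** Another neighbor [z] of [w] would extend [c], [y], [w] to a path of length 3 without repetition,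
    putting [z] at distance 3 from [c]. *)
Lemma neighbors_far w y : adj c y -> adj y w -> w != c -> ~~ adj c w ->
  neighbors w = [set y].
Proof.
move=> cy yw wc ncw; apply/setP => z; rewrite mem_neighbors inE.
apply/idP/eqP => [wz|->]; last by rewrite adj_sym.
apply: contraTeq (center_dist_le2 z) => zy; rewrite -ltnNge.
have cz : path (@adj T) c [:: y; w; z] by rewrite /= cy yw wz.
rewrite (acyclic_dist T_acyc cz) //= !inE !negb_or.
rewrite (adj_neq cy) (adj_neq yw) (adj_neq wz) eq_sym wc [y == z]eq_sym zy !andbT /=.
by apply: contraNneq ncw => ->; rewrite adj_sym.
Qed.

Lemma nonpendant_adj_center v : ~~ pendant v -> v != c -> adj c v.
Proof.
move=> npv vc; case: (centerP v) => // [Dv|y cy yv _ ncv].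
  by rewrite Dv eqxx in vc.
by rewrite /pendant (neighbors_far cy yv) ?cards1 in npv.
Qed.

Lemma pendant_of_adj2 v w : adj c v -> adj v w -> w != c -> pendant w.
Proof.
move=> cv vw wc; rewrite /pendant (neighbors_far cv vw) ?cards1 //.
(* If [w] were adjacent to [c], then [c], [v], [w] would be a triangle. *)
apply/negP => cw; have := T_acyc (c := [:: c; v; w]).
rewrite /ucycle /= cv vw [adj w c]adj_sym cw !inE negb_or (adj_neq cv) (adj_neq vw).
by rewrite eq_sym wc => /(_ isT).
Qed.

Lemma nonpendantI v u w : adj v u -> adj v w -> u != w -> ~~ pendant v.
Proof.
move=> vu vw uw; rewrite /pendant; apply/cards1P => -[x Dv].
move: vu vw uw; rewrite -!mem_neighbors Dv !inE => /eqP-> /eqP->.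
by rewrite eqxx.
Qed.

(** Both ends of a diametral path are within distance 2 of [c] and at distance 4 from each other,
    hence at distance exactly 2 from [c]. The middle vertices of the two paths from [c] to these
    ends are the witnesses. *)
Lemma center_two_nonpendants : exists y z,
  [/\ adj c y, adj c z, y != z, ~~ pendant y & ~~ pendant z].
Proof.
have [a [e]] : exists a e : T, dist a e = diameter T.
  by apply: diameter_attained; case: T_tree => -[].
rewrite T_diam => Dae.
have [p cp [Da Up szp]] := dist_path (T_conn c a).
have [q cq [De Uq szq]] := dist_path (T_conn c e).
have lep := center_dist_le2 a; have leq := center_dist_le2 e.
rewrite -szp in lep; rewrite -szq in leq.
have pathD p' q' x : path (@adj T) x p' -> path (@adj T) x q' ->
    last x p' = a -> last x q' = e -> 4 <= size p' + size q'.
  move=> xp xq Dxa Dxe.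
  have ap : path (@adj T) a (rev (belast x p') ++ q').
    rewrite cat_path -{1}Dxa rev_path_adj //=.
    by case: (p') Dxa => [|h t] /= => [<-|_] //; rewrite rev_cons last_rcons.
  have := dist_le_size ap; rewrite last_cat.
  have -> : last a (rev (belast x p')) = x.
    by case: (p') Dxa => [|h t] /= => [->|_] //; rewrite rev_cons last_rcons.
  by rewrite Dxe Dae size_cat size_rev size_belast.
have := pathD _ _ _ cp cq Da De; move=> sum4.
case: p cp Da Up szp lep sum4 => [|y [|a' []]] //= cp Da Up _ _; last first.
  case: q cq De Uq szq leq => [|z [|e' []]] //= cq De Uq _ _ _.
  case/and3P: cp => cy ya _; case/and3P: cq => cz ze _.
  exists y, z; split=> //.
  (* A shared middle vertex would join the ends by a walk of length 2. *)
  - apply/negP => /eqP Dy.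
    by have := pathD [:: a'] [:: e'] y; rewrite /= ya Dy ze; case/(_ isT isT Da De)/negP.
  - apply: (@nonpendantI _ c a') => //; first by rewrite adj_sym.
    by move: Up; rewrite !inE negb_or => /andP[/andP[]].
  - apply: (@nonpendantI _ c e') => //; first by rewrite adj_sym.
    by move: Uq; rewrite !inE negb_or => /andP[/andP[]].
- by rewrite add1n ltnS => /leq_trans/(_ leq).
- by rewrite add0n => /leq_trans/(_ leq).
Qed.

Lemma center_nonpendant : ~~ pendant c.
Proof.
by have [y [z [cy cz yz _ _]]] := center_two_nonpendants; apply: nonpendantI yz.
Qed.

Lemma pendant_neighbors_noncenter v : ~~ pendant v -> v != c ->
  pendant_neighbors v = neighbors v :\ c.
Proof.
move=> npv vc; have cv := nonpendant_adj_center npv vc.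
apply/setP => w; rewrite !inE andbC; have [->|wc] := eqVneq w c.
  by rewrite (negbTE center_nonpendant).
by case vw: (adj v w); rewrite ?andbF //= (pendant_of_adj2 cv vw).
Qed.

Lemma noncenter_support v : ~~ pendant v -> v != c -> 0 < #|pendant_neighbors v|.
Proof.
move=> npv vc; rewrite pendant_neighbors_noncenter //.
have := cardsD1 c (neighbors v); rewrite mem_neighbors adj_sym.
rewrite (nonpendant_adj_center npv vc) => Dv.
by move: npv; rewrite /pendant Dv; case: #|_|.
Qed.

(** This ensures that the neighbor of a pendant vertex never carries a correcting label. That
    neighbor is either [c] or a vertex adjacent to both [c] and [u]. *)
Lemma pendant_adj_nonpendant u v : pendant u -> adj u v -> ~~ pendant v.
Proof.
move=> pu uv; case: (centerP u) => [Du|cu|y cy yu uc _].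
- by have := center_nonpendant; rewrite -Du pu.
- have [->|vc] := eqVneq v c; first exact: center_nonpendant.
  have : ~~ pendant u by apply: nonpendantI uv _ vc; rewrite adj_sym.
  by rewrite pu.
- have Dv : v = y.
    by apply/eqP; apply: contraTT pu => vy; apply: nonpendantI uv _ vy; rewrite adj_sym.
  rewrite Dv; apply: (@nonpendantI _ c u) => //; first by rewrite adj_sym.
  by rewrite eq_sym.
Qed.

End Center.
End Diameter4.

(** * Construction of magic labelings *)

Section Labeling.
Variables (Gamma : zmodType) (G : sgraph).
Local Open Scope ring_scope.

Lemma weight_pendant (l : G -> Gamma) (u v : G) :
  pendant u -> adj u v -> weight l u = l v.
Proof.
case/cards1P => x Du; rewrite -mem_neighbors Du inE => /eqP->.
by rewrite /weight Du big_set1.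
Qed.

(* Every vertex gets the label [m], except for one chosen pendant neighbor of
   each vertex [v], whose label [(2 - deg v) m] corrects the weight of [v]. *)
Lemma vertex_magic_supports (m : Gamma) :
    torsion_free Gamma -> m != 0 ->
    (forall u v : G, pendant u -> adj u v -> ~~ pendant v) ->
    (forall v : G, ~~ pendant v ->
       (0 < #|pendant_neighbors v|)%N && (2 < #|neighbors v|)%N) ->
  vertex_magic Gamma G.
Proof.
move=> tf m0 pnp supp.
pose chosen (v : G) := [pick u in pendant_neighbors v].
pose l (u : G) := if [pick v | chosen v == Some u] is Some v
            then m *+ 2 - m *+ #|neighbors v| else m.
have chosenP v u : chosen v = Some u -> pendant u /\ adj v u.
  by rewrite /chosen; case: pickP => // x + [<-]; rewrite !inE => /andP[].
(* A pendant vertex has a single neighbor, so at most one vertex chooses it. *)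
have uniq_nb (u v w : G) : pendant u -> adj u v -> adj u w -> v = w.
  case/cards1P => x Du; rewrite -!mem_neighbors Du !inE.
  by move=> /eqP-> /eqP->.
have l_np v : ~~ pendant v -> l v = m.
  rewrite /l; case: pickP => // x /eqP/chosenP[pv _].
  by rewrite pv.
exists l; split=> [u|].
  rewrite /l; case: pickP => // v /eqP/chosenP[pu vu].
  have npv : ~~ pendant v by apply: (pnp u) => //; rewrite adj_sym.
  have /andP[_ deg3] := supp v npv.
  (* A zero label would give (deg v - 2) m = 0 with deg v - 2 positive. *)
  rewrite subr_eq0; apply: contra_neq m0 => /esym/eqP.
  rewrite -subr_eq0 -mulrnBr 1?ltnW // => /eqP; apply: tf.
  by rewrite subn_gt0.
exists m => v; case/boolP: (pendant v) => [pv|npv].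
  have /cards1P[x Dv] := pv.
  have vx : adj v x by rewrite -mem_neighbors Dv set11.
  by rewrite (weight_pendant _ pv vx) l_np // (pnp v).
have /andP[pn_gt0 deg3] := supp v npv.
have [u Du] : exists u, chosen v = Some u.
  rewrite /chosen; case: pickP => [u _|none]; first by exists u.
  by move: pn_gt0; rewrite (eq_card0 none).
have [pu vu] := chosenP _ _ Du.
rewrite /weight (bigD1 u) ?mem_neighbors //=.
have -> : l u = m *+ 2 - m *+ #|neighbors v|.
  rewrite /l; case: pickP => [x /eqP Dx|/(_ v)]; last by rewrite Du eqxx.
  have [_ xu] := chosenP _ _ Dx.
  by rewrite (uniq_nb u x v) // adj_sym.
rewrite (eq_bigr (fun=> m)); last first.
  move=> w /andP[]; rewrite mem_neighbors => vw wu.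
  rewrite /l; case: pickP => // x /eqP Dx; have [pw xw] := chosenP _ _ Dx.
  have Dxv : x = v by apply: (uniq_nb w); rewrite // adj_sym.
  by move: Dx wu; rewrite Dxv Du => -[->]; rewrite eqxx.
rewrite sumr_const.
have -> : #|[pred w | (w \in neighbors v) && (w != u)]| = #|neighbors v :\ u|.
  by apply: eq_card => w; rewrite !inE andbC.
(* The weight is (2 - d) m + (d - 1) m = m, where d is the degree of [v]. *)
rewrite (cardsD1 u (neighbors v)) mem_neighbors vu mulrnDr.
by rewrite mulr2n opprD addrA addrK subrK.
Qed.

End Labeling.

Lemma infinite_group_neq0 (Gamma : zmodType) :
  infinite_group Gamma -> exists m : Gamma, m != 0%R.
Proof.
move=> inf; apply: boolp.contrapT => none; apply: inf.
apply: (@cardinality.sub_finite_set _ _ (classical_sets.set1 (0%R : Gamma))).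
  move=> x _; apply/eqP; apply: boolp.contrapT => /negP x0.
  by apply: none; exists x.
exact: cardinality.finite_set1.
Qed.

(** * The characterization by support vertices *)

Theorem theorem4p2 (Gamma : zmodType)
    (Gamma_inf : infinite_group Gamma) (Gamma_tf : torsion_free Gamma)
    (T : sgraph) (T_tree : is_tree T) (T_diam : diameter T = 4)
    (vc : T) (vc_center : vc \in center T) :
  vertex_magic Gamma T <->
  (forall v : T, ~~ pendant v -> v \in strong_supports T) \/
  (vc \in weak_supports T /\
   forall v : T, ~~ pendant v -> v != vc -> v \in strong_supports T).
Proof.
have np_vc := center_nonpendant T_tree T_diam vc_center.
have adj_vc v := @nonpendant_adj_center _ T_tree T_diam _ vc_center v.
have [y [z [cy cz yz npy npz]]] := center_two_nonpendants T_tree T_diam vc_center.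
split=> [[l [l0 [mu Dmu]]]|strong].
  have l_supp v : (0 < #|pendant_neighbors v|)%N -> l v = mu.
    case/card_gt0P => u; rewrite !inE => /andP[vu pu].
    by rewrite -(weight_pendant l pu) // adj_sym.
  have supp v : ~~ pendant v -> v != vc -> (0 < #|pendant_neighbors v|)%N.
    exact: noncenter_support.
  have deg2 : (1 < #|neighbors vc|)%N.
    rewrite (cardsD1 y) mem_neighbors cy ltnS card_gt0.
    by apply/set0Pn; exists z; rewrite !inE eq_sym yz.
  have supp_vc : (0 < #|pendant_neighbors vc|)%N.
    rewrite lt0n; apply/negP => /eqP/cards0_eq no_pn.
    have := Dmu vc; rewrite /weight (eq_bigr (fun=> mu)); last first.
      move=> v; rewrite mem_neighbors => cv.
      apply: l_supp; apply: supp; last by rewrite eq_sym (adj_neq cv).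
      by apply/negP => pv; move/setP/(_ v): no_pn; rewrite !inE cv pv.
    (* With k the degree of [vc], cancelling one [mu] in k [mu] = [mu] leaves (k - 1) [mu] = 0, and
       k - 1 is positive. *)
    rewrite sumr_const -(subnKC deg2) mulrnDr mulr2n -addrA -[RHS]addr0.
    move=> /addrI; rewrite -mulrS => /Gamma_tf mu0.
    by move: (l0 y); rewrite l_supp ?mu0 ?eqxx // supp // eq_sym (adj_neq cy).
  have strong v : ~~ pendant v -> v != vc -> v \in strong_supports T.
    move=> npv vvc; rewrite inE ltn_neqAle supp // andbT eq_sym.
    (* With a single pendant neighbor [u], the weight of [v] is [mu + l u], which forces
       [l u = 0]. *)
    apply/cards1P => -[u Du]; have := Dmu v.
    rewrite /weight (bigD1 vc) ?mem_neighbors 1?adj_sym ?adj_vc //=.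
    rewrite (eq_bigl (mem (pendant_neighbors v))); last first.
      move=> w; rewrite (pendant_neighbors_noncenter T_tree T_diam vc_center) //.
      by rewrite !inE andbC.
    rewrite l_supp // Du big_set1 -[RHS]addr0 => /addrI lu0.
    by move: (l0 u); rewrite lu0 eqxx.
  have [weak|nweak] := boolP (vc \in weak_supports T); [right | left] => // v npv.
  have [->|] := eqVneq v vc; last exact: strong.
  by move: nweak; rewrite !inE ltn_neqAle supp_vc andbT eq_sym.
have strong_nc v : ~~ pendant v -> v != vc -> v \in strong_supports T.
  by case: strong => [all_s|[_ +]] npv vvc; [apply: all_s | apply].
have supp_vc : (0 < #|pendant_neighbors vc|)%N.
  case: strong => [/(_ vc np_vc)|[]]; rewrite inE; first exact: ltnW.
  by move/eqP->.
have [m m0] := infinite_group_neq0 Gamma_inf.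
apply: (vertex_magic_supports Gamma_tf m0).
  exact: (pendant_adj_nonpendant T_tree T_diam vc_center).
move=> v npv; have [->|vvc] := eqVneq v vc.
  rewrite supp_vc /=; have /card_gt0P[u] := supp_vc.
  rewrite !inE => /andP[cu pu].
  (* A pendant neighbor and the two non-pendant ones give [vc] degree at least 3. *)
  have /subset_leq_card : [set u; y; z] \subset neighbors vc.
    by apply/subsetP => w; rewrite !inE -orbA => /or3P[] /eqP->.
  have uy : u != y by apply: contraNneq npy => <-.
  have uz : u != z by apply: contraNneq npz => <-.
  by rewrite -setUA cardsU1 cards2 !inE negb_or uy uz yz.
(* Two pendant neighbors together with [vc] give [v] degree at least 3. *)
have := strong_nc v npv vvc; rewrite inE => two; rewrite (ltnW two) /=.
move: two; rewrite (pendant_neighbors_noncenter T_tree T_diam vc_center) //.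
by rewrite (cardsD1 vc (neighbors v)) mem_neighbors adj_sym adj_vc.
Qed.
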